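(* Assume the following. (I) $\mathcal X_2\hookrightarrow\mathcal X_1\hookrightarrow\mathcal X_0$, $\mathcal Z_2\hookrightarrow\mathcal Z_1\hookrightarrow\mathcal Z_0$ and $\mathcal Y$ are Banach spaces, and $D_2\subset D_1\subset D_0$ are sets such that $D_j$ is open in $\mathcal X_j\times\mathcal Y$ and $(0,0)\in D_j\subset\mathcal X_j\times\mathcal Y$ for $j=0,1,2$. (II) For $j=1,2$, $F\in C^1(D_j,\mathcal Z_{j-1})\cap C(D_{j-1},\mathcal Z_{j-1})$ with $F(0,0)=0$, and $\partial_xF\in C(D_j,\mathcal L(\mathcal X_{j-1},\mathcal Z_{j-1}))$; the latter is understood to mean that for $(x,y)\in D_j$ the partial derivative $\partial_xF(x,y)\in\mathcal L(\mathcal X_j,\mathcal Z_{j-1})$ can be extended to $\overline{\partial_xF}(x,y)\in\mathcal L(\mathcal X_{j-1},\mathcal Z_{j-1})$ and $\overline{\partial_xF}\in C(D_j,\mathcal L(\mathcal X_{j-1},\mathcal Z_{j-1}))$. (III) For $j=1,2$, the mapping $F\colon D_j\to\mathcal Z_j$ is Fréchet-differentiable at $(0,0)$. (IV) For $j=0,1,2$, the inverse $\partial_xF(0,0)^{-1}\in\mathcal L(\mathcal Z_j,\mathcal X_j)$ exists. Then there exist neighbourhoods of zero $0\in U_0\subset\mathcal X_0$, $0\in U_1\subset\mathcal X_1$ and $0\in V\subset\mathcal Y$ such that there is a function $u\colon V\to U_1$ satisfying: (i) $F(u(y),y)=0$ for all $y\in V$, and $u(0)=0$; (ii) if $x\in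 U_1$ and $y\in V$ are such that $F(x,y)=0$, then $x=u(y)$; (iii) $u\in C^1(V,\mathcal X_0)$, and \[ u'(y)=-\partial_xF(u(y),y)^{-1}\,\partial_yF(u(y),y), \] with $\partial_xF(u(y),y)^{-1}\in\mathcal L(\mathcal Z_0,\mathcal X_0)$ and $\partial_yF(u(y),y)\in\mathcal L(\mathcal Y,\mathcal Z_0)$.
   Context: $\mathcal L(A,B)$ denotes the space of bounded linear operators from $A$ to $B$ with the operator norm, and $A\hookrightarrow B$ means that $A$ is continuously embedded in $B$. $F=F(x,y)$ is a single map on $D_0$ whose restrictions to $D_1$ and $D_2$ are considered with respect to the topologies of $\mathcal X_j\times\mathcal Y$ and the indicated target spaces; $\partial_xF$ and $\partial_yF$ are its partial Fréchet derivatives. In (IV) and in (iii), $\partial_xF$ acting on a larger space (e.g. as an element of $\mathcal L(\mathcal X_0,\mathcal Z_0)$) means the extension $\overline{\partial_xF}$ from (II); for $j=1,2$ the derivative $\partial_xF(0,0)$ lies in $\mathcal L(\mathcal X_j,\mathcal Z_j)$ by (III). *)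

(* Defs.v *)
From HB Require Import structures.
From mathcomp Require Import all_boot all_order all_algebra.
From mathcomp Require Import all_classical all_reals.
From mathcomp Require Import topology normedtype derive.

Set Implicit Arguments.
Unset Strict Implicit.
Unset Printing Implicit Defensive.

Import Order.TTheory GRing.Theory Num.Theory.
Import numFieldNormedType.Exports.

Local Open Scope classical_set_scope.
Local Open Scope ring_scope.

Reserved Notation "''L' ( V , W )" (at level 8, format "''L' ( V ,  W )").

Section BoundedOperators.
Context {R : realType} (V W : normedModType R).

(* For linear maps, continuity is boundedness, see [linear_bounded_continuous]. *)
Definition bounded_op_pred : {pred V -> W} :=
  mem [set f : V -> W | linear f /\ continuous f].

Record bounded_op := BoundedOp {
  bounded_op_fun :> V -> W ;
  bounded_op_subproof : bounded_op_fun \in bounded_op_pred }.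

HB.instance Definition _ := [isSub for bounded_op_fun].
HB.instance Definition _ := [Choice of bounded_op by <:].

Lemma bounded_op_submod_closed : submod_closed bounded_op_pred.
Proof.
split.
  by rewrite inE; split=> [a x y /=|x]; [rewrite scaler0 addr0 | exact: cvg_cst].
move=> a f g; rewrite !inE => -[lf cf] [lg cg]; split=> [b x y|x].
  rewrite !fctE lf lg !scalerDr -!addrA; congr (_ + _).
    by rewrite !scalerA mulrC.
  by rewrite addrCA.
by apply: cvgD; [apply: cvgZr; exact: cf | exact: cg].
Qed.

HB.instance Definition _ := GRing.isSubmodClosed.Build R (V -> W)
  bounded_op_pred bounded_op_submod_closed.
HB.instance Definition _ := [SubChoice_isSubLmodule of bounded_op by <:].

Lemma bounded_op_linear (f : bounded_op) : linear f.
Proof. by case: f => f /=; rewrite inE => -[]. Qed.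

Lemma bounded_op_continuous (f : bounded_op) : continuous f.
Proof. by case: f => f /=; rewrite inE => -[]. Qed.

HB.instance Definition _ (f : bounded_op) :=
  GRing.isLinear.Build R V W *:%R (bounded_op_fun f) (bounded_op_linear f).

Lemma bounded_opP (f g : bounded_op) : f =1 g -> f = g.
Proof. by move=> fg; apply: val_inj; apply/funext. Qed.

(* The supremum is finite, see [op_norm_has_sup]. *)
Definition op_norm (f : bounded_op) : R :=
  sup [set `|f x| | x in [set x : V | `|x| <= 1]].

Lemma op_norm_has_sup (f : bounded_op) :
  has_sup [set `|f x| | x in [set x : V | `|x| <= 1]].
Proof.
split; first by exists `|f 0|, 0 => //=; rewrite normr0.
have /bounded_funP/(_ 1)[M fM] : bounded_near f (nbhs (0 : V)).
  by apply: continuous_linear_bounded; exact: bounded_op_continuous.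
by exists M => _ [x /= x1 <-]; exact: fM.
Qed.

Lemma op_norm_ub (f : bounded_op) x : `|x| <= 1 -> `|f x| <= op_norm f.
Proof.
move=> x1; apply: sup_upper_bound; first exact: op_norm_has_sup.
by exists x.
Qed.

Lemma op_norm_le (f : bounded_op) M :
  (forall x, `|x| <= 1 -> `|f x| <= M) -> op_norm f <= M.
Proof.
move=> fM; apply: ge_sup; first by have [] := op_norm_has_sup f.
by move=> _ [x /= x1 <-]; exact: fM.
Qed.

Lemma op_norm_ge0 (f : bounded_op) : 0 <= op_norm f.
Proof. by apply: (le_trans _ (@op_norm_ub f 0 _)); rewrite ?normr0. Qed.

Lemma op_normP (f : bounded_op) x : `|f x| <= op_norm f * `|x|.
Proof.
have [->|x0] := eqVneq x 0; first by rewrite linear0 !normr0 mulr0.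
have nx0 : 0 < `|x| by rewrite normr_gt0.
rewrite -ler_pdivrMr// mulrC.
have -> : `|x|^-1 * `|f x| = `|f (`|x|^-1 *: x)|.
  by rewrite linearZ normrZ normfV normr_id.
by apply: op_norm_ub; rewrite normrZ normfV normr_id mulVf// gt_eqF.
Qed.

Lemma ler_op_normD f g : op_norm (f + g) <= op_norm f + op_norm g.
Proof.
apply: op_norm_le => x x1; rewrite (le_trans (ler_normD _ _))//.
by rewrite lerD// op_norm_ub.
Qed.

Lemma op_normZ (l : R) f : op_norm (l *: f) = `|l| * op_norm f.
Proof.
have le (k : R) h : op_norm (k *: h) <= `|k| * op_norm h.
  apply: op_norm_le => x x1.
  have -> : (k *: h) x = k *: h x by [].
  by rewrite normrZ ler_wpM2l// op_norm_ub.
apply/eqP; rewrite eq_le le/=.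
have [->|l0] := eqVneq l 0; first by rewrite normr0 mul0r op_norm_ge0.
rewrite -ler_pdivlMl ?normr_gt0// -normfV.
by rewrite -{1}[f](scalerK l0) le.
Qed.

Lemma op_norm0_eq0 f : op_norm f = 0 -> f = 0.
Proof.
move=> f0; apply: bounded_opP => x; apply/eqP.
have -> : (0 : bounded_op) x = 0 by [].
by rewrite -normr_le0 (le_trans (op_normP f x))// f0 mul0r.
Qed.

HB.instance Definition _ := @Lmodule_isNormed.Build R bounded_op
  op_norm ler_op_normD op_normZ op_norm0_eq0.

End BoundedOperators.

Notation "''L' ( V , W )" := (bounded_op V W) : type_scope.

Definition op_inverse {R : realType} (V W : normedModType R)
    (f : V -> W) (g : 'L(W, V)) : Prop := cancel f g /\ cancel g f.

(* Functions on an open subset D of V are represented by total functions on V.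
   As D is open, [{in D, continuous f}], which uses the neighbourhoods in V of
   the points of D, is continuity of the restriction of f to D. For the same
   reason the differentials below do not depend on values outside D. *)
Definition C1_on {R : realType} (V W : normedModType R) (D : set V)
    (f : V -> W) : Prop :=
  exists2 df : V -> 'L(V, W),
    {in D, forall p, is_diff p f (df p)} & {in D, continuous df}.

Section PartialDifferentials.
Context {R : realType} {X Y Z : normedModType R}.

Definition partial_x (f : X * Y -> Z) (p : X * Y) : {linear X -> Z} :=
  'd (fun x : X => f (x, p.2)) (p.1).

Definition partial_y (f : X * Y -> Z) (p : X * Y) : {linear Y -> Z} :=
  'd (fun y : Y => f (p.1, y)) (p.2).

End PartialDifferentials.

(* When [i] embeds X in X', [F \o lift_x i] is F seen as a map on X * Y, with
   the topology of X * Y. *)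
Definition lift_x {R : realType} {X X' : normedModType R}
    (Y : normedModType R) (i : 'L(X, X')) (p : X * Y) : X' * Y := (i p.1, p.2).
Arguments lift_x {R X X' Y} i p.

(* Main.v *)
Require Import Defs.
From HB Require Import structures.
From mathcomp Require Import all_boot all_order all_algebra.
From mathcomp Require Import all_classical all_reals.
From mathcomp Require Import topology normedtype derive sequences landau.
From mathcomp Require Import interval_inference prodnormedzmodule.
From mathcomp Require Import ring lra.
Import Order.TTheory GRing.Theory Num.Theory.
Import numFieldNormedType.Exports.
Local Open Scope classical_set_scope.
Local Open Scope ring_scope.

(** The Newton-like iteration [x - B (F (x, y))], with [B] the inverse of the
    partial derivative of [F] in x at the origin, cannot be run in one space: a
    step taken in [X2] is only bounded there, and it is a contraction only for
    the weaker norm of [X1]. The proof lets each pair of consecutive spaces do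
    what it can.

    - Existence. Differentiability of [F2] at the origin alone gives
      [|x - B2 (F2 (x, y))| <= |x| / 2 + L |y|] ([quasi_newton_bound]), so the
      iterates started from 0 stay in a small ball of [X2]. On such a ball
      continuity of the extended derivative [A2] and the mean value inequality
      make the same step a contraction for the norm of [X1], up to a term
      [K |y - y'|] ([quasi_newton_lipschitz]). Hence the iterates converge in
      [X1], to a limit [u y] which is Lipschitz in y ([quasi_newton_limit]).
      The limit may leave [X2], but it lies in [X1], where [F1] is continuous,
      so that it is a zero of [F1].
    - Uniqueness. The same contraction lemma one level down, on a ball of [X1]
      with the norm of [X0], separates the zeros of [F0] in that ball.
    - Differentiability. Since [u] is Lipschitz into [X1], and [F0] is
      differentiable on [D1] for the topology of [X1 * Y], the expansion of [F0]
      at [(u y, y)] has a remainder [o(|k|)]. Its linear part is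
      [A1 (u y, y)] applied to the increment of [u] seen in [X0], and that
      operator is invertible from [X0] to [Z0] near the origin
      ([neumann_inverse]). Solving for the increment gives the derivative
      ([implicit_is_diff]). It is continuous because [y |-> (u y, y)] is
      continuous into [X1 * Y], on which [A1] and the differential of [F0] are
      continuous.

    The embeddings need not have dense range, so [A2 (0, 0)] may differ from the
    derivative of [F1] at the origin outside the range of [X2]; the contraction
    estimate only ever evaluates [A2] on differences of points of [X2], where
    the two agree. *)

(** * Differentials and the mean value inequality *)

Section Differentials.
Context {R : realType} {V W : normedModType R}.

Lemma diff_approx (f : V -> W) x (e : R) : differentiable f x -> 0 < e ->
  exists2 d : R, 0 < d &
    forall h, `|h| < d -> `|f (x + h) - f x - 'd f x h| <= e * `|h|.
Proof.
move=> /diff_locally/eqaddoP fx e0.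
have /nbhs_norm0P[d d0 dP] := fx e e0.
exists d => // h /dP /=.
have -> : (f \o shift x - (cst (f x) + 'd f x)) h = f (h + x) - (f x + 'd f x h).
  by [].
by rewrite (addrC h) opprD addrA.
Qed.

Lemma approx_is_diff (f : V -> W) x (df : 'L(V, W)) :
  (forall e : R, 0 < e -> exists2 d : R, 0 < d &
    forall h, `|h| < d -> `|f (x + h) - f x - df h| <= e * `|h|) ->
  is_diff x f df.
Proof.
move=> dfP.
have fo : f \o shift x = cst (f x) + (df : {linear V -> W}) +o_ 0 id.
  apply/eqaddoP => e /dfP[d d0 dP]; apply/nbhs_norm0P; exists d => // h /= /dP.
  have -> : (f \o shift x - (cst (f x) + df)) h = f (h + x) - (f x + df h) by [].
  by rewrite (addrC h) opprD addrA.
have dfE := diff_unique (@bounded_op_continuous _ _ _ df) fo.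
split; last exact: dfE.
apply/diff_locallyP; rewrite dfE; split => //; exact: bounded_op_continuous.
Qed.

End Differentials.

Section MeanValue.
Context {R : realType}.

(** The set of the times up to which the Lipschitz bound from 0 holds has a
    supremum, and the local bound there pushes the estimate through the
    supremum and past it. *)
Lemma local_lipschitz_unit {W : normedModType R} (f : R -> W) (K : R) :
  (forall t : R, 0 <= t <= 1 -> exists2 d : R, 0 < d &
    forall s, 0 <= s <= 1 -> `|s - t| < d -> `|f s - f t| <= K * `|s - t|) ->
  `|f 1 - f 0| <= K.
Proof.
move=> fK; pose S := [set t : R | 0 <= t <= 1 /\ `|f t - f 0| <= K * t].
have S0 : S 0 by split; rewrite ?lexx ?ler01 ?subrr ?normr0 ?mulr0.
have S1 : ubound S 1 by move=> t [/andP[]].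
have supS : has_sup S by split; [exists 0|exists 1].
pose s := sup S.
have s01 : 0 <= s <= 1.
  by rewrite sup_upper_bound// ge_sup//; exists 0.
have [d d0 sd] := fK _ s01.
(* A point of S at distance less than d from s passes its bound on to any
   point of the unit interval to its right across s. *)
have step t : s <= t <= 1 -> t < s + d -> S t.
  move=> /andP[st t1] tsd.
  have [t' St' t's] := sup_adherent d0 supS.
  have t'les : t' <= s by exact: sup_upper_bound.
  case: St' => /andP[t'0 t'1] t'K.
  have t01 : 0 <= t <= 1 by case/andP: s01 => s0 _; rewrite (le_trans s0).
  split => //.
  have -> : f t - f 0 = (f t - f s) - (f t' - f s) + (f t' - f 0).
    by rewrite opprB !subrKA.
  rewrite (le_trans (ler_normD _ _))// (le_trans (lerD (ler_normB _ _) t'K))//.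
  have := sd _ t01; rewrite ger0_norm ?subr_ge0// => /(_ _)/le_trans.
  have t'01 : 0 <= t' <= 1 by rewrite t'0.
  have := sd _ t'01; rewrite ler0_norm ?subr_le0//.
  have -> : - (t' - s) < d by rewrite -/s in t's; lra.
  have -> : t - s < d by lra.
  move=> /(_ isT) h1 h2; have {}h2 := h2 _ isT (lexx _).
  by apply: (le_trans (lerD (lerD h2 h1) (lexx _))); lra.
suff : S 1 by case=> _; rewrite mulr1.
have [s1|s1] := ltP (s + d / 2) 1; last first.
  by apply: step; [rewrite lexx; case/andP: s01 => _ ->|lra].
have /(sup_upper_bound supS) : S (s + d / 2) by apply: step; lra.
rewrite -/s; lra.
Qed.

(** Subtracting the linear path of slope [w] turns the bound on [f' h - w] into
    a local Lipschitz bound, with an arbitrarily small loss. The constant [w]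
    lets the increment of [f] be compared with its linearization at another
    point. *)
Lemma mean_value {V W : normedModType R} (f : V -> W) (a h : V) (w : W) (M : R) :
  (forall t : R, 0 <= t <= 1 -> differentiable f (a + t *: h) /\
     `|'d f (a + t *: h) h - w| <= M) ->
  `|f (a + h) - f a - w| <= M.
Proof.
move=> fM; apply/ler_addgt0Pr => e e0.
pose g t := f (a + t *: h) - t *: w.
have -> : f (a + h) - f a - w = g 1 - g 0.
  by rewrite /g !scale1r !scale0r addr0 subr0 addrAC.
(* [|h| + 1] stands for [|h|] in denominators, as [h] may be 0. *)
have c0 : 0 < `|h| + 1 by rewrite ltr_wpDl.
apply: local_lipschitz_unit => t t01; have [ft dM] := fM t t01.
have [d d0 dP] := diff_approx f _ (e / (`|h| + 1)) ft (divr_gt0 e0 c0).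
exists (d / (`|h| + 1)); first exact: divr_gt0.
move=> s s01; rewrite ltr_pdivlMr// => std.
have := dP ((s - t) *: h).
have -> : a + t *: h + (s - t) *: h = a + s *: h.
  by rewrite -addrA -scalerDl (addrC t) subrK.
rewrite normrZ.
have -> : `|s - t| * `|h| < d.
  by rewrite (le_lt_trans _ std)// ler_wpM2l// lerDl.
move=> /(_ isT) dPst.
have -> : g s - g t = (f (a + s *: h) - f (a + t *: h)
    - 'd f (a + t *: h) ((s - t) *: h)) + (s - t) *: ('d f (a + t *: h) h - w).
  rewrite linearZ /= scalerBr subrKA scalerBl /g !opprB.
  by rewrite addrACA [RHS]addrACA; congr (_ + _); rewrite addrC.
rewrite (le_trans (ler_normD _ _))// normrZ mulrDl [leRHS]addrC.
apply: lerD; last by rewrite mulrC ler_wpM2r.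
apply: (le_trans dPst); rewrite mulrCA [leRHS]mulrC ler_wpM2l//.
by rewrite mulrAC ler_pdivrMr// ler_wpM2l ?ltW// ltrDl.
Qed.

End MeanValue.

(** * Composition and inversion of bounded operators *)

Section BoundedOperatorAlgebra.
Context {R : realType}.

Definition mk_op {V W : normedModType R} (f : V -> W)
    (lf : linear f) (cf : continuous f) : 'L(V, W) :=
  BoundedOp (mem_set (conj lf cf) : f \in @bounded_op_pred R V W).

Definition op_comp {U V W : normedModType R} (f : 'L(V, W)) (g : 'L(U, V)) :
  'L(U, W).
Proof.
apply: (@mk_op _ _ (f \o g)) => [a x y /=|x]; first by rewrite !linearP.
by apply: continuous_comp; exact: bounded_op_continuous.
Defined.

Definition op_inr (V W : normedModType R) : 'L(W, (V * W)%type).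
Proof.
apply: (@mk_op _ _ (fun x => (0, x))) => [a x y|x].
  by congr pair; rewrite /= scaler0 addr0.
by apply: cvg_pair; [exact: cvg_cst|exact: cvg_id].
Defined.

Lemma ler_op_norm {V W : normedModType R} (f : 'L(V, W)) x :
  `|f x| <= `|f| * `|x|.
Proof. exact: op_normP. Qed.

Lemma op_comp_norm {U V W : normedModType R} (f : 'L(V, W)) (g : 'L(U, V)) :
  `|op_comp f g| <= `|f| * `|g|.
Proof.
apply: op_norm_le => x x1 /=; apply: (le_trans (ler_op_norm _ _)).
by rewrite ler_wpM2l// op_norm_ub.
Qed.

Lemma cvg_op_comp {T : Type} {F : set_system T} {FF : Filter F}
    {U V W : normedModType R} (f : T -> 'L(V, W)) (g : T -> 'L(U, V)) f0 g0 :
  f t @[t --> F] --> f0 -> g t @[t --> F] --> g0 ->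
  op_comp (f t) (g t) @[t --> F] --> op_comp f0 g0.
Proof.
move=> ff0 gg0; apply/cvgrPdist_le => e e0.
have bound t : `|op_comp f0 g0 - op_comp (f t) (g t)| <=
    `|f0 - f t| * `|g0| + `|f t| * `|g0 - g t|.
  have -> : op_comp f0 g0 - op_comp (f t) (g t) =
      op_comp (f0 - f t) g0 + op_comp (f t) (g0 - g t).
    apply: bounded_opP => x.
    have -> : (op_comp f0 g0 - op_comp (f t) (g t)) x = f0 (g0 x) - f t (g t x).
      by [].
    have -> : (op_comp (f0 - f t) g0 + op_comp (f t) (g0 - g t)) x =
      (f0 (g0 x) - f t (g0 x)) + f t (g0 x - g t x) by [].
    by rewrite linearB /= subrKA.
  by rewrite (le_trans (ler_normD _ _))// lerD// op_comp_norm.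
near=> t; apply: (le_trans (bound t)); near: t.
suff : `|f0 - f t| * `|g0| + `|f t| * `|g0 - g t| @[t --> F] --> (0 : R).
  move=> /cvgrPdist_le/(_ e e0); apply: filterS => t.
  by rewrite sub0r normrN ger0_norm// addr_ge0// mulr_ge0.
have -> : 0 = `|f0 - f0| * `|g0| + `|f0| * `|g0 - g0| :> R.
  by rewrite !subrr !normr0 mul0r mulr0 addr0.
apply: cvgD; apply: cvgM; [|exact: cvg_cst|exact: cvg_norm|].
- by apply: cvg_norm; apply: cvgB => //; exact: cvg_cst.
- by apply: cvg_norm; apply: cvgB => //; exact: cvg_cst.
Unshelve. all: by end_near. Qed.

End BoundedOperatorAlgebra.

Section Inverses.
Context {R : realType}.

(** Solving [A x = z] amounts to finding a fixed point of
    [x |-> B0 (z - (A - A0) x)], a contraction of the complete space [X], whose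
    iterates from 0 are the partial sums of the Neumann series; the bound on the
    inverse comes from [|x| <= |B0| |A x| + |x| / 2]. *)
Lemma neumann_inverse {X : completeNormedModType R} {Z : normedModType R}
    (A0 A : 'L(X, Z)) (B0 : 'L(Z, X)) :
  op_inverse A0 B0 -> `|B0| * `|A - A0| <= 2^-1 ->
  exists2 B : 'L(Z, X), op_inverse A B & `|B| <= 2 * `|B0|.
Proof.
move=> [A0K B0K] AA0.
have half x : `|B0 ((A - A0) x)| <= 2^-1 * `|x|.
  rewrite (le_trans (ler_op_norm _ _))//.
  rewrite (le_trans (ler_wpM2l (normr_ge0 _) (ler_op_norm _ _)))// mulrA.
  by rewrite ler_wpM2r.
have below x : `|x| <= 2 * (`|B0| * `|A x|).
  have : `|x| <= `|B0| * `|A x| + 2^-1 * `|x|.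
    rewrite -{1}(A0K x).
    have -> : A0 x = A x - (A - A0) x.
      by rewrite -[(A - A0) x]/(A x - A0 x) opprB addrC subrK.
    by rewrite linearB /= (le_trans (ler_normB _ _))// lerD ?ler_op_norm ?half.
  lra.
have surj z : exists x, A x = z.
  pose f x := B0 (z - (A - A0) x).
  have fT : {homo f : x / setT x >-> setT x} by [].
  have fctr : is_contraction (mkfun_fun fT).
    exists (2^-1 : R)%:nng; split => /=; first lra.
    move=> [x x'] _ /=.
    have -> : f x - f x' = B0 ((A - A0) (x' - x)).
      have cancel_z (C : 'L(X, Z)) : z - C x - (z - C x') = C (x' - x).
        by rewrite [in RHS]linearB opprB addrC subrKA.
      by rewrite /f -linearB cancel_z.
    by rewrite distrC half.
  have [x _ fx] := banach_fixed_point fctr closedT (ex_intro _ 0 I).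
  exists x; have := congr1 A0 fx; rewrite /= /f B0K.
  rewrite -[(A - A0) x]/(A x - A0 x) opprB addrCA => /eqP.
  by rewrite -[X in X == _]addr0 (inj_eq (addrI _)) eq_sym subr_eq0 eq_sym => /eqP.
have [g gK] := choice surj.
have gK' : cancel A g.
  move=> x; apply/eqP; rewrite -subr_eq0 -normr_le0 (le_trans (below _))//.
  by rewrite linearB /= gK subrr normr0 !mulr0.
have lg : linear g.
  by move=> a x y; apply: (can_inj gK'); rewrite gK [RHS]linearP /= !gK.
have gB z : `|g z| <= 2 * `|B0| * `|z| by rewrite -mulrA -{2}(gK z).
have cg : continuous g.
  pose gl : {linear Z -> X} := HB.pack g (GRing.isLinear.Build R Z X *:%R g lg).
  apply: (@bounded_linear_continuous R _ _ gl).
  apply/bounded_funP => r; exists (2 * `|B0| * r) => z zr.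
  by rewrite (le_trans (gB z))// ler_wpM2l// mulr_ge0.
exists (mk_op g lg cg); first by split.
apply: op_norm_le => z z1; apply: (le_trans (gB z)).
by rewrite ler_piMr// mulr_ge0.
Qed.

(** This is the resolvent identity [B - B' = - B (A - A') B']. *)
Lemma op_inverse_dist {X Z : normedModType R}
    {A A' : 'L(X, Z)} {B B' : 'L(Z, X)} :
  op_inverse A B -> op_inverse A' B' ->
  `|B - B'| <= `|B| * `|A - A'| * `|B'|.
Proof.
move=> [AK BK] [AK' BK'].
have -> : B - B' = - op_comp B (op_comp (A - A') B').
  apply: bounded_opP => z.
  have -> : (- op_comp B (op_comp (A - A') B')) z = - B (A (B' z) - A' (B' z)).
    by [].
  by rewrite BK' linearB /= AK opprB.
rewrite normrN (le_trans (op_comp_norm _ _))// -mulrA ler_wpM2l//.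
exact: op_comp_norm.
Qed.

End Inverses.

(** * Partial derivatives *)

Section PartialDerivatives.
Context {R : realType} {X Y Z : normedModType R}.

Lemma near0_pair (P : X * Y -> Prop) : (\forall p \near (0, 0), P p) ->
  exists2 r : R, 0 < r & forall x y, `|x| < r -> `|y| < r -> P (x, y).
Proof.
move=> /nbhs_norm0P[r r0 rP]; exists r => // x y xr yr; apply: rP => /=.
by rewrite prod_normE /= gt_max xr yr.
Qed.

Lemma norm_0pair (y : Y) : `|(0 : X, y)| = `|y|.
Proof. by rewrite prod_normE /= normr0; apply/max_idPr. Qed.

Lemma partial_xE (G : X * Y -> Z) p h : differentiable G p ->
  partial_x G p h = 'd G p (h, 0).
Proof.
case: p => x y dG; rewrite /partial_x /=.
have di : is_diff x (fun x => (x, y)) (fun h => (h, 0)).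
  exact: is_diff_pair.
have -> : (fun x => G (x, y)) = G \o (fun x => (x, y)) by [].
by rewrite diff_comp// diff_val.
Qed.

Lemma partial_yE (G : X * Y -> Z) p k : differentiable G p ->
  partial_y G p k = 'd G p (0, k).
Proof.
case: p => x y dG; rewrite /partial_y /=.
have di : is_diff y (fun y => (x, y)) (fun k => (0, k)).
  exact: is_diff_pair.
have -> : (fun y => G (x, y)) = G \o (fun y => (x, y)) by [].
by rewrite diff_comp// diff_val.
Qed.

End PartialDerivatives.

Section PartialDerivativeRules.
Context {R : realType}.

Lemma partial_x_lift {X X' Y Z : normedModType R} (i : 'L(X, X'))
    (F : X' * Y -> Z) (p : X * Y) h : differentiable F (lift_x i p) ->
  partial_x (F \o lift_x i) p h = partial_x F (lift_x i p) (i h).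
Proof.
case: p => x y dF; rewrite /partial_x /lift_x /=.
have di : is_diff (i x) (fun x' => (x', y)) (fun h => (h, 0)).
  exact: is_diff_pair.
have -> : (fun z => (F \o lift_x i) (z, y)) =
  (F \o (fun x' => (x', y))) \o i by [].
have ci := @bounded_op_continuous _ _ _ i.
have di' := linear_differentiable x ci.
rewrite (@diff_comp _ _ _ _ i (F \o (fun x' => (x', y))) x) //.
  by rewrite (diff_lin _ ci).
exact: differentiable_comp.
Qed.

(** The equality of [j \o F] with [G] holds only near [p], as when [F] and [G] are
    the restrictions of one map to the open domain of [F], with values in a
    smaller space. *)
Lemma diff_near_op {X Z Z' : normedModType R} (j : 'L(Z, Z'))
    (F : X -> Z) (G : X -> Z') (p : X) h :
  differentiable F p -> (\forall q \near p, j (F q) = G q) ->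
  'd G p h = j ('d F p h).
Proof.
move=> dF FG.
pose dFo : 'L(X, Z) :=
  mk_op ('d F p) (@linearP _ _ _ _ ('d F p)) (diff_continuous dF).
suff dG : is_diff p G (op_comp j dFo) by rewrite (@diff_val _ _ _ _ _ _ _ dG).
apply: approx_is_diff => e e0.
have j0 : 0 < `|j| + 1 by rewrite ltr_wpDl.
have [d d0 dP] := diff_approx F _ _ dF (divr_gt0 e0 j0).
have /nbhs_ballP[d' /= d'0 d'P] := FG.
exists (Num.min d d'); first by rewrite lt_min d0.
move=> k; rewrite lt_min => /andP[kd kd'].
rewrite -!d'P ?ball_normE/=; last 2 first.
- by rewrite -ball_normE /= subrr normr0.
- by rewrite -ball_normE /= opprD addrA subrr sub0r normrN.
have jB a b : j (a - b) = j a - j b by exact: linearB.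
rewrite -!jB (le_trans (ler_op_norm _ _))//.
rewrite (le_trans (ler_wpM2l (normr_ge0 _) (dP _ kd)))//.
rewrite mulrA ler_wpM2r// mulrCA ler_piMr ?(ltW e0)// ler_pdivrMr// mul1r.
by rewrite lerDl.
Qed.

End PartialDerivativeRules.

(** * The Newton-like step *)

(** The radius of the balls is chosen so that operators and remainders are
    controlled by [(2 (b + 1))^-1], with [b] the norm of the inverse; the shift by
    1 covers [b = 0]. *)
Lemma mul_half_inv {R : realType} (b : R) :
  0 <= b -> b * (2 * (b + 1))^-1 <= 2^-1.
Proof. by move=> b0; rewrite ler_pdivrMr; lra. Qed.

Section QuasiNewton.
Context {R : realType} {X' X Y Z : normedModType R}.

(** Along a segment in [X'] the derivative of [G] is [A p (i h)], whose distance to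
    [A (0, 0) (i h)] is measured by the norm of [i h] in the larger space [X]; as
    [B] inverts [A (0, 0)] on the range of [i], the step contracts for that norm.
    The increment in y is controlled by the boundedness of the differential near
    the origin. *)
Lemma quasi_newton_lipschitz (i : 'L(X', X)) (D : set (X' * Y))
    (G : X' * Y -> Z) (A : X' * Y -> 'L(X, Z)) (B : 'L(Z, X)) :
  open_nbhs (0, 0) D -> C1_on D G ->
  {in D, forall p, forall h, A p (i h) = partial_x G p h} ->
  {in D, continuous A} ->
  (forall h, B (A (0, 0) (i h)) = i h) ->
  exists2 r : R, 0 < r & exists2 K : R, 0 <= K &
    (forall x y, `|x| < r -> `|y| < r -> D (x, y)) /\
    (forall x x' y y', `|x| < r -> `|x'| < r -> `|y| < r -> `|y'| < r ->
       `|(i x - B (G (x, y))) - (i x' - B (G (x', y')))|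
         <= 2^-1 * `|i x - i x'| + K * `|y - y'|).
Proof.
move=> [oD D0] [dG GdG cdG] AG cA BA.
pose e : R := (2 * (`|B| + 1))^-1.
have c0 : 0 < 2 * (`|B| + 1) by rewrite mulr_gt0// ltr_wpDl.
have e0 : 0 < e by rewrite invr_gt0.
have D0' : (0, 0) \in D by exact: mem_set.
have nearD : \forall p \near (0, 0), D p by exact: open_nbhs_nbhs.
have nearA : \forall p \near (0, 0), `|A p - A (0, 0)| <= e.
  by have /cvgrPdistC_le := cA _ D0'; exact.
have neardG : \forall p \near (0, 0), `|dG p| <= `|dG (0, 0)| + 1.
  have /cvgrPdistC_le/(_ 1 ltr01) := cdG _ D0'; apply: filterS => p pd.
  rewrite -[dG p](subrK (dG (0, 0))) (le_trans (ler_normD _ _))// addrC.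
  by rewrite lerD2l.
have [r r0 rP] := near0_pair _ (filterI nearD (filterI nearA neardG)).
have K0 : 0 <= `|B| * (`|dG (0, 0)| + 1) by rewrite mulr_ge0// addr_ge0.
exists r => //; exists (`|B| * (`|dG (0, 0)| + 1)) => //; split.
  by move=> x y xr yr; have [] := rP _ _ xr yr.
move=> x x' y y' xr x'r yr y'r.
have seg (V : normedModType R) (a b : V) (t : R) : 0 <= t <= 1 ->
    `|a| < r -> `|b| < r -> `|a + t *: (b - a)| < r.
  move=> /andP[t0 t1] ar br.
  have -> : a + t *: (b - a) = (1 - t) *: a + t *: b.
    by rewrite scalerBr scalerBl scale1r addrA addrAC.
  rewrite (le_lt_trans (ler_normD _ _))// !normrZ (ger0_norm t0).
  rewrite ger0_norm ?subr_ge0//.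
  have [m [am bm mr]] : exists m, [/\ `|a| <= m, `|b| <= m & m < r].
    by exists (Num.max `|a| `|b|); rewrite !le_max !lexx orbT gt_max ar br.
  by apply: le_lt_trans mr; nra.
(* First move x with y fixed, then y with x' fixed. *)
have Gx : `|G (x, y) - G (x', y) - A (0, 0) (i (x - x'))| <= e * `|i (x - x')|.
  have -> : G (x, y) = G ((x', y) + (x - x', 0)).
    by congr (G (_, _)); rewrite /= ?addr0// addrC subrK.
  apply: mean_value => t t01.
  have [Dp [Ap _]] := rP _ _ (seg _ _ _ _ t01 x'r xr) yr.
  have -> : (x', y) + t *: (x - x', 0) = (x' + t *: (x - x'), y).
    by congr pair; rewrite /= scaler0 addr0.
  have pD := mem_set Dp.
  have dGp := GdG _ pD; split; first exact: ex_diff.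
  rewrite -partial_xE// -AG//.
  rewrite -[_ - _]/((A (x' + t *: (x - x'), y) - A (0, 0)) (i (x - x'))).
  by rewrite (le_trans (ler_op_norm _ _))// ler_wpM2r.
have Gy : `|G (x', y) - G (x', y')| <= (`|dG (0, 0)| + 1) * `|y - y'|.
  have -> : G (x', y) = G ((x', y') + (0, y - y')).
    by congr (G (_, _)); rewrite /= ?addr0// addrC subrK.
  rewrite -[X in `|X|]subr0; apply: mean_value => t t01.
  have [Dp [_ dGle]] := rP _ _ x'r (seg _ _ _ _ t01 y'r yr).
  have -> : (x', y') + t *: (0, y - y') = (x', y' + t *: (y - y')).
    by congr pair; rewrite /= scaler0 addr0.
  have dGp := GdG _ (mem_set Dp); split; first exact: ex_diff.
  rewrite subr0 (@diff_val _ _ _ _ _ _ _ dGp) (le_trans (ler_op_norm _ _))//.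
  by rewrite norm_0pair ler_wpM2r.
have -> : i x - B (G (x, y)) - (i x' - B (G (x', y'))) =
    - B (G (x, y) - G (x', y) - A (0, 0) (i (x - x')))
    - B (G (x', y) - G (x', y')).
  have BB a b : B (a - b) = B a - B b by exact: linearB.
  have iB a b : i (a - b) = i a - i b by exact: linearB.
  rewrite !BB BA iB [in LHS]opprD addrACA opprK !opprB -[RHS]addrA.
  by rewrite [X in _ = _ + X]addrC subrKA (addrC (- _)).
rewrite (le_trans (ler_normB _ _))// normrN lerD//.
  rewrite (le_trans (ler_op_norm _ _))//.
  rewrite (le_trans (ler_wpM2l (normr_ge0 _) Gx))// -linearB mulrA ler_wpM2r//.
  exact: mul_half_inv.
by rewrite (le_trans (ler_op_norm _ _))// -mulrA ler_wpM2l//.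
Qed.

End QuasiNewton.

(** The linear part of [x - B (F (x, y))] has no x component, and the remainder of
    the expansion at the origin is small compared with [|(x, y)|]; half of [|y|]
    in that remainder goes into [L |y|]. *)
Lemma quasi_newton_bound {R : realType} {X Y Z : normedModType R}
    (F : X * Y -> Z) (B : 'L(Z, X)) :
  differentiable F (0, 0) -> F (0, 0) = 0 ->
  (forall h, B (partial_x F (0, 0) h) = h) ->
  exists2 r : R, 0 < r & exists2 L : R, 0 <= L &
    forall x y, `|x| < r -> `|y| < r ->
      `|x - B (F (x, y))| <= 2^-1 * `|x| + L * `|y|.
Proof.
move=> dF F0 BF.
pose d : 'L((X * Y)%type, Z) :=
  mk_op ('d F (0, 0)) (@linearP _ _ _ _ ('d F (0, 0))) (diff_continuous dF).
have e0 : 0 < (2 * (`|B| + 1))^-1 by rewrite invr_gt0 mulr_gt0// ltr_wpDl.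
have [r r0 rP] := diff_approx F _ _ dF e0.
exists r => //; exists (2^-1 + `|B| * `|d|) => [|x y xr yr].
  by rewrite addr_ge0// mulr_ge0.
have := rP (x, y); rewrite F0 subr0.
have -> : (0, 0) + (x, y) = (x, y) by congr pair; rewrite /= add0r.
have -> : `|(x, y)| < r by rewrite prod_normE /= gt_max xr.
move=> /(_ isT) Fxy.
have -> : x - B (F (x, y)) = - (B (F (x, y) - d (x, y)) + B (d (0, y))).
  have -> : d (x, y) = partial_x F (0, 0) x + d (0, y).
    rewrite partial_xE// -linearD; congr ('d F _ _).
    by congr pair; rewrite /= ?addr0 ?add0r.
  have BB a b : B (a - b) = B a - B b by exact: linearB.
  have BD a b : B (a + b) = B a + B b by exact: linearD.
  by rewrite BB BD BF opprD opprB addrAC addrK.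
rewrite normrN (le_trans (ler_normD _ _))//.
have -> : 2^-1 * `|x| + (2^-1 + `|B| * `|d|) * `|y| =
    2^-1 * (`|x| + `|y|) + `|B| * (`|d| * `|y|) by ring.
apply: lerD.
  rewrite (le_trans (ler_op_norm _ _))//.
  rewrite (le_trans (ler_wpM2l (normr_ge0 _) Fxy))// mulrA.
  apply: ler_pM; rewrite ?mul_half_inv ?mulr_ge0 ?(ltW e0)//.
  by rewrite prod_normE /= ge_max lerDl lerDr !normr_ge0.
rewrite (le_trans (ler_op_norm _ _))// ler_wpM2l//.
by rewrite (le_trans (ler_op_norm _ _))// norm_0pair.
Qed.

Lemma geometric_cvg {R : realType} {V : completeNormedModType R}
    (v : nat -> V) (c : R) :
  (forall n, `|v n.+1 - v n| <= c * 2^-1 ^+ n) -> cvgn v.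
Proof.
move=> vc.
have sv : cvgn (series (telescope v)).
  apply: normed_cvg; apply: (@series_le_cvg _ _ (geometric c 2^-1)) => [n|n|n|].
  - exact: normr_ge0.
  - exact: le_trans (vc n).
  - exact: vc.
  - by apply: is_cvg_geometric_series; rewrite ger0_norm; lra.
have -> : v = (fun n => v 0%N + series (telescope v) n).
  by apply/funext => n; rewrite -eq_sum_telescope.
by apply: is_cvgD => //; exact: is_cvg_cst.
Qed.

(** The first estimate keeps the iterates of [S ^~ y] from 0 in the ball of radius
    [2 L |y|] of [X2]; the second makes their images in [X1] converge
    geometrically. It also gives the bound [2 K |y - y'|] between the iterates
    for two parameters, by induction since [2^-1 * (2 K) + K = 2 K], hence between
    the limits. *)
Lemma quasi_newton_limit {R : realType} {X1 : completeNormedModType R}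
    {X2 Y : normedModType R} (i : 'L(X2, X1)) (S : X2 -> Y -> X2) (r L K : R) :
  0 < r -> 0 <= L -> 0 <= K ->
  (forall x y, `|x| < r -> `|y| < r -> `|S x y| <= 2^-1 * `|x| + L * `|y|) ->
  (forall x x' y y', `|x| < r -> `|x'| < r -> `|y| < r -> `|y'| < r ->
     `|i (S x y) - i (S x' y')| <= 2^-1 * `|i x - i x'| + K * `|y - y'|) ->
  exists2 d : R, 0 < d & exists u : Y -> X1,
    [/\ u 0 = 0,
        forall y y', `|y| < d -> `|y'| < d ->
          `|u y - u y'| <= 2 * K * `|y - y'| &
        forall y, `|y| < d -> exists2 x : nat -> X2,
          forall n, `|x n| < r /\ x n.+1 = S (x n) y &
          i (x n) @[n --> \oo] --> u y].
Proof.
move=> r0 L0 K0 SL SK.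
pose x y n := iter n (S ^~ y) 0.
have xS y n : x y n.+1 = S (x y n) y by [].
pose d := r / (2 * L + 1); exists d.
  by rewrite divr_gt0// ltr_wpDl// mulr_ge0.
have yd (y : Y) : `|y| < d -> 2 * L * `|y| < r /\ `|y| < r.
  rewrite ltr_pdivlMr ?ltr_wpDl ?mulr_ge0// => yr.
  have := normr_ge0 y; have := mulr_ge0 L0 (normr_ge0 y).
  by split; nra.
have xle y n : `|y| < d -> `|x y n| <= 2 * L * `|y|.
  move=> /yd[Ly yr]; elim: n => [|n IH]; first by rewrite normr0 !mulr_ge0.
  rewrite xS.
  rewrite (le_trans (SL _ _ (le_lt_trans IH Ly) yr))//; nra.
have xr y n : `|y| < d -> `|x y n| < r.
  by move=> yy; rewrite (le_lt_trans (xle _ _ yy))//; have [] := yd _ yy.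
have xcvg y : `|y| < d -> cvgn (fun n => i (x y n)).
  move=> yy; apply: (geometric_cvg _ `|i (x y 1%N) - i (x y 0%N)|).
  elim=> [|n IH]; first by rewrite expr0 mulr1.
  have [_ yr] := yd _ yy.
  rewrite (xS _ n.+1) [in X in _ - X]xS.
  rewrite (le_trans (SK _ _ _ _ (xr _ _ yy) (xr _ _ yy) yr yr))//.
  rewrite subrr normr0 mulr0 addr0 exprS mulrCA ler_wpM2l//.
exists (fun y => limn (fun n => i (x y n))).
have xlip y y' n : `|y| < d -> `|y'| < d ->
    `|i (x y n) - i (x y' n)| <= 2 * K * `|y - y'|.
  move=> yy yy'; elim: n => [|n IH]; first by rewrite subrr normr0 !mulr_ge0.
  rewrite !xS.
  have [_ yr] := yd _ yy; have [_ yr'] := yd _ yy'.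
  rewrite (le_trans (SK _ _ _ _ (xr _ _ yy) (xr _ _ yy') yr yr'))//; lra.
have d0 : `|0 : Y| < d by rewrite normr0 divr_gt0// ltr_wpDl// mulr_ge0.
split.
- have x0 n : i (x 0 n) = 0.
    have := xle 0 n d0; rewrite normr0 mulr0 normr_le0 => /eqP ->.
    by rewrite linear0.
  by under eq_fun do rewrite x0; exact: lim_cst.
- move=> y y' yy yy'.
  have uB : `|i (x y n) - i (x y' n)| @[n --> \oo] -->
      `|limn (fun n => i (x y n)) - limn (fun n => i (x y' n))|.
    by apply: cvg_norm; apply: cvgB; exact: xcvg.
  by apply: (cvgr_to_le uB); apply: nearW => n; exact: xlip.
- move=> y yy; exists (x y) => [n|]; last exact: xcvg.
  by split => //; exact: xr.
Qed.

(** With [h] the increment of [u] in [X'], [A (i h) + C k] is the linear part of an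
    increment of [G] that vanishes, hence it is [o(|(h, k)|)], which is [o(|k|)] as
    [u] is Lipschitz into [X']; then apply [B]. Since [A] is inverted on [X] only,
    this controls the increment of [i \o u], not that of [u]. *)
Lemma implicit_is_diff {R : realType} {X' X Y Z : normedModType R}
    (i : 'L(X', X)) (G : X' * Y -> Z) (u : Y -> X') (y : Y)
    (A : 'L(X, Z)) (B : 'L(Z, X)) (C : 'L(Y, Z)) (d M : R) :
  differentiable G (u y, y) ->
  (forall h, A (i h) = 'd G (u y, y) (h, 0)) ->
  (forall k, C k = 'd G (u y, y) (0, k)) ->
  cancel A B -> 0 < d ->
  (forall k, `|k| < d -> `|u (y + k) - u y| <= M * `|k|) ->
  (forall k, `|k| < d -> G (u (y + k), y + k) = G (u y, y)) ->
  is_diff y (i \o u) (- op_comp B C : 'L(Y, X)).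
Proof.
move=> dG AG CG AK d0 uM Gu; apply: approx_is_diff => e e0.
(* The pair [(h, k)] has norm at most [(|M| + 1) |k|], and [B] is applied to the
   remainder; [N] is a positive bound of the product of both factors. *)
pose N := `|B| * (`|M| + 1) + 1.
have N0 : 0 < N by rewrite ltr_wpDl// mulr_ge0// addr_ge0.
have [r r0 rP] := diff_approx G _ _ dG (divr_gt0 e0 N0).
have M0 : 0 < `|M| + 1 by rewrite ltr_wpDl.
exists (Num.min d (r / (`|M| + 1))); first by rewrite lt_min d0 divr_gt0.
move=> k; rewrite lt_min ltr_pdivlMr// => /andP[kd kr].
set h := u (y + k) - u y.
have hk : `|(h, k)| <= `|k| * (`|M| + 1).
  rewrite prod_normE /= ge_max mulrC; apply/andP; split.
    rewrite (le_trans (uM _ kd))// ler_wpM2r// (le_trans (ler_norm _))// lerDl//.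
  by rewrite ler_peMl// lerDr.
have := rP (h, k) (le_lt_trans hk kr).
have -> : (u y, y) + (h, k) = (u (y + k), y + k).
  by congr pair; rewrite /= /h addrC subrK.
rewrite Gu// subrr sub0r normrN => Ge.
have -> : (i \o u) (y + k) - (i \o u) y - (- op_comp B C : 'L(Y, X)) k =
    B ('d G (u y, y) (h, k)).
  rewrite -[(- op_comp B C : 'L(Y, X)) k]/(- B (C k)) opprK /=.
  have -> : i (u (y + k)) - i (u y) = i h by rewrite linearB.
  have BD a b : B (a + b) = B a + B b by exact: linearD.
  rewrite -{1}(AK (i h)) -BD AG CG -linearD.
  by congr (B ('d G _ _)); congr pair; rewrite /= ?addr0 ?add0r.
rewrite (le_trans (ler_op_norm _ _))//.
rewrite (le_trans (ler_wpM2l (normr_ge0 _) (le_trans Ge (ler_wpM2l _ hk))))//.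
  by rewrite ltW// divr_gt0.
have -> : `|B| * (e / N * (`|k| * (`|M| + 1))) =
  e * `|k| * (`|B| * (`|M| + 1) / N) by ring.
by rewrite ler_piMr ?mulr_ge0 ?(ltW e0)// ler_pdivrMr// mul1r lerDl.
Qed.

(** * The implicit function *)

Lemma mem_ball0 {R : realType} {V : normedModType R} (r : R) (x : V) :
  ball 0 r x = (`|x| < r) :> Prop.
Proof. by rewrite -ball_normE /= sub0r normrN. Qed.

Theorem theorem4p2 (R : realType)
  (* (I): the embeddings are the bounded injections iX and iZ *)
  (X0 X1 X2 Y Z0 Z1 Z2 : completeNormedModType R)
  (iX10 : 'L(X1, X0)) (iX21 : 'L(X2, X1))
  (iZ10 : 'L(Z1, Z0)) (iZ21 : 'L(Z2, Z1))
  (iX10_inj : injective iX10) (iX21_inj : injective iX21)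
  (iZ10_inj : injective iZ10) (iZ21_inj : injective iZ21)
  (D0 : set (X0 * Y)) (D1 : set (X1 * Y)) (D2 : set (X2 * Y))
  (D0_nbhs : open_nbhs (0, 0) D0)
  (D1_nbhs : open_nbhs (0, 0) D1)
  (D2_nbhs : open_nbhs (0, 0) D2)
  (D1_sub : lift_x iX10 @` D1 `<=` D0)
  (D2_sub : lift_x iX21 @` D2 `<=` D1)
  (* the map F0 on D0, whose restriction to Dj is Fj with values in Zj *)
  (F0 : X0 * Y -> Z0) (F1 : X1 * Y -> Z1) (F2 : X2 * Y -> Z2)
  (F1_restr : {in D1, forall p, iZ10 (F1 p) = F0 (lift_x iX10 p)})
  (F2_restr : {in D2, forall p, iZ21 (F2 p) = F1 (lift_x iX21 p)})
  (* (II), j = 1; A1 is the extension of the partial derivative in x *)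
  (F_C1_1 : C1_on D1 (F0 \o lift_x iX10))
  (F_C_0 : {in D0, continuous F0})
  (F0_0 : F0 (0, 0) = 0)
  (A1 : X1 * Y -> 'L(X0, Z0))
  (A1_ext : {in D1, forall p, forall h : X1,
     A1 p (iX10 h) = partial_x (F0 \o lift_x iX10) p h})
  (A1_cont : {in D1, continuous A1})
  (* (II), j = 2; A2 is the extension of the partial derivative in x *)
  (F_C1_2 : C1_on D2 (F1 \o lift_x iX21))
  (F_C_1 : {in D1, continuous F1})
  (F1_0 : F1 (0, 0) = 0)
  (A2 : X2 * Y -> 'L(X1, Z1))
  (A2_ext : {in D2, forall p, forall h : X2,
     A2 p (iX21 h) = partial_x (F1 \o lift_x iX21) p h})
  (A2_cont : {in D2, continuous A2})
  (* (III) *)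
  (F1_diff : differentiable F1 (0, 0))
  (F2_diff : differentiable F2 (0, 0))
  (* (IV) *)
  (inv0 : exists B : 'L(Z0, X0), op_inverse (A1 (0, 0)) B)
  (inv1 : exists B : 'L(Z1, X1), op_inverse (partial_x F1 (0, 0)) B)
  (inv2 : exists B : 'L(Z2, X2), op_inverse (partial_x F2 (0, 0)) B) :
  exists (U0 : set X0) (U1 : set X1) (V : set Y),
    [/\ open_nbhs 0 U0, open_nbhs 0 U1, open_nbhs 0 V,
        (* F is defined on U1 * V *)
        U1 `*` V `<=` D1 &
    exists u : Y -> X1,
      [/\ (forall y, V y -> U1 (u y)),
          (* (i) *)
          (forall y, V y -> F0 (iX10 (u y), y) = 0) /\ u 0 = 0,
          (* (ii) *)
          (forall x y, U1 x -> V y -> F0 (iX10 x, y) = 0 -> x = u y) &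
          (* (iii) *)
          C1_on V (iX10 \o u) /\
          forall y, V y -> exists (B : 'L(Z0, X0)) (C : 'L(Y, Z0)),
            [/\ op_inverse (A1 (u y, y)) B,
                C =1 partial_y (F0 \o lift_x iX10) (u y, y) &
                forall k : Y, 'd (iX10 \o u) y k = - B (C k)]]].
Proof.
have D1_0 : (0, 0) \in D1 by exact: mem_set (proj2 D1_nbhs).
have D2_0 : (0, 0) \in D2 by exact: mem_set (proj2 D2_nbhs).
have lift0 : lift_x iX21 (0, 0) = (0, 0) :> X1 * Y.
  by rewrite /lift_x /= linear0.
have F2_0 : F2 (0, 0) = 0.
  by apply: iZ21_inj; rewrite (F2_restr _ D2_0) lift0 F1_0 linear0.
have [B0 [A0K B0K]] := inv0.
have [B1 [P1K B1K]] := inv1.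
have [B2 [P2K B2K]] := inv2.
set G1 := F0 \o lift_x iX10 in F_C1_1 A1_ext *.
set G2 := F1 \o lift_x iX21 in F_C1_2 A2_ext.
(* The x-derivatives at the origin of [F1] and [F2] agree along the embeddings,
   hence so do their inverses, and the step computed in [X2] with [B2] is also
   the step computed in [X1] with [B1]. *)
have P12 h : partial_x G2 (0, 0) h = partial_x F1 (0, 0) (iX21 h).
  by rewrite /G2 partial_x_lift lift0.
have P22 h : partial_x G2 (0, 0) h = iZ21 (partial_x F2 (0, 0) h).
  have [dG2 G2d _] := F_C1_2; have dG20 := G2d _ D2_0.
  rewrite partial_xE; last exact: (@ex_diff _ _ _ _ _ _ _ dG20).
  rewrite partial_xE//; apply: diff_near_op => //.
  have : \forall q \near (0, 0), D2 q by exact: open_nbhs_nbhs.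
  by apply: filterS => q /mem_set/F2_restr.
have B12 z : iX21 (B2 z) = B1 (iZ21 z).
  by rewrite -[in RHS](B2K z) -P22 P12 P1K.
have [r1 r1_gt0 [K1 K1_ge0 [D1r est1]]] :
  exists2 r : R, 0 < r & exists2 K : R, 0 <= K &
    (forall x y, `|x| < r -> `|y| < r -> D1 (x, y)) /\
    (forall x x' y y', `|x| < r -> `|x'| < r -> `|y| < r -> `|y'| < r ->
       `|(iX10 x - B0 (G1 (x, y))) - (iX10 x' - B0 (G1 (x', y')))|
         <= 2^-1 * `|iX10 x - iX10 x'| + K * `|y - y'|).
  by apply: (quasi_newton_lipschitz _ _ _ A1) => // h; exact: A0K.
have [r2 r2_gt0 [K2 K2_ge0 [D2r est2]]] :
  exists2 r : R, 0 < r & exists2 K : R, 0 <= K &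
    (forall x y, `|x| < r -> `|y| < r -> D2 (x, y)) /\
    (forall x x' y y', `|x| < r -> `|x'| < r -> `|y| < r -> `|y'| < r ->
       `|(iX21 x - B1 (G2 (x, y))) - (iX21 x' - B1 (G2 (x', y')))|
         <= 2^-1 * `|iX21 x - iX21 x'| + K * `|y - y'|).
  apply: (quasi_newton_lipschitz _ _ _ A2) => // h.
  by rewrite A2_ext// P12 P1K.
have [r3 r3_gt0 [L L_ge0 est3]] := quasi_newton_bound F2 B2 F2_diff F2_0 P2K.
have newton_step x y : `|x| < r2 -> `|y| < r2 ->
    iX21 (x - B2 (F2 (x, y))) = iX21 x - B1 (G2 (x, y)).
  by move=> xr yr; rewrite linearB /= B12 (F2_restr _ (mem_set (D2r _ _ xr yr))).
pose r := Num.min r2 r3.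
have r_gt0 : 0 < r by rewrite lt_min r2_gt0.
have ltr2 (t : R) : t < r -> t < r2 by rewrite lt_min => /andP[].
have ltr3 (t : R) : t < r -> t < r3 by rewrite lt_min => /andP[].
pose S x y := x - B2 (F2 (x, y)).
have S_bound x y : `|x| < r -> `|y| < r ->
  `|S x y| <= 2^-1 * `|x| + L * `|y|.
  by move=> /ltr3 xr /ltr3 yr; exact: est3.
have S_contr x x' y y' : `|x| < r -> `|x'| < r -> `|y| < r -> `|y'| < r ->
  `|iX21 (S x y) - iX21 (S x' y')|
    <= 2^-1 * `|iX21 x - iX21 x'| + K2 * `|y - y'|.
  move=> /ltr2 xr /ltr2 x'r /ltr2 yr /ltr2 y'r.
  by rewrite /S !newton_step//; exact: est2.
have [d d_gt0 [u [u0 ulip useq]]] :=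
  quasi_newton_limit iX21 S r L K2 r_gt0 L_ge0 K2_ge0 S_bound S_contr.
have [r4 r4_gt0 A1near] : exists2 r : R, 0 < r & forall x y,
    `|x| < r -> `|y| < r -> `|B0| * `|A1 (x, y) - A1 (0, 0)| <= 2^-1.
  apply: (near0_pair (fun p => `|B0| * `|A1 p - A1 (0, 0)| <= 2^-1)).
  have e0 : 0 < (2 * (`|B0| + 1))^-1 by rewrite invr_gt0 mulr_gt0// ltr_wpDl.
  have /cvgrPdistC_le/(_ _ e0) := A1_cont _ D1_0; apply: filterS => p pe.
  by rewrite (le_trans (ler_wpM2l (normr_ge0 _) pe))// mul_half_inv.
(* On the ball of radius [rho] zeros are unique and [A1] is invertible; [delta] is
   such that [u] maps the ball of radius [delta] into the ball of radius [rho]. *)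
pose rho := Num.min r1 r4.
have rho_gt0 : 0 < rho by rewrite lt_min r1_gt0.
have ltr1 (t : R) : t < rho -> t < r1 by rewrite lt_min => /andP[].
have ltr4 (t : R) : t < rho -> t < r4 by rewrite lt_min => /andP[].
have K2'_gt0 : 0 < 2 * K2 + 1 by rewrite ltr_wpDl// mulr_ge0.
pose delta := Num.min (Num.min d r) (Num.min rho (rho / (2 * K2 + 1))).
have delta_gt0 : 0 < delta.
  by rewrite lt_min lt_min d_gt0 r_gt0 lt_min rho_gt0 divr_gt0.
have ltd (t : R) : t < delta -> t < d.
  by rewrite lt_min => /andP[]; rewrite lt_min => /andP[].
have ltr (t : R) : t < delta -> t < r.
  by rewrite lt_min => /andP[]; rewrite lt_min => /andP[].
have ltrho (t : R) : t < delta -> t < rho.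
  by rewrite lt_min => /andP[_]; rewrite lt_min => /andP[].
have u_small y : `|y| < delta -> `|u y| < rho.
  move=> yd; have := yd; rewrite lt_min => /andP[_]; rewrite lt_min => /andP[_].
  rewrite ltr_pdivlMr// => yrho.
  have := ulip y 0 (ltd _ yd); rewrite u0 !subr0 normr0 => /(_ d_gt0) uy.
  by rewrite (le_lt_trans uy)// (le_lt_trans _ yrho)// mulrDr mulr1 mulrC lerDl.
have D1u y : `|y| < delta -> D1 (u y, y).
  by move=> yd; apply: D1r; apply: ltr1; [exact: u_small|exact: ltrho].
have G1E x y : D1 (x, y) -> iZ10 (F1 (x, y)) = G1 (x, y).
  by move=> Dxy; rewrite (F1_restr _ (mem_set Dxy)).
have u_sol y : `|y| < delta -> G1 (u y, y) = 0.
  move=> yd; rewrite -G1E; last exact: D1u.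
  suff -> : F1 (u y, y) = 0 by rewrite linear0.
  have [x xP xu] := useq y (ltd _ yd).
  have Du : (u y, y) \in D1 by apply: mem_set; exact: D1u.
  have pair_cvgs : (iX21 (x n), y) @[n --> \oo] --> (u y, y).
    by apply: cvg_pair => //; exact: cvg_cst.
  have F1x : F1 (iX21 (x n), y) @[n --> \oo] --> F1 (u y, y).
    by apply: (cvg_comp _ _ pair_cvgs); exact: F_C_1.
  have B1x : B1 (F1 (iX21 (x n), y)) @[n --> \oo] --> B1 (F1 (u y, y)).
    by apply: (cvg_comp _ _ F1x); exact: bounded_op_continuous.
  have residual n : B1 (F1 (iX21 (x n), y)) = iX21 (x n) - iX21 (x n.+1).
    have [/ltr2 xr ->] := xP n; rewrite /S newton_step//.
      by rewrite opprB addrC subrK.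
    exact: (ltr2 _ (ltr _ yd)).
  have xuS : iX21 (x n.+1) @[n --> \oo] --> u y.
    by rewrite -(cvg_shiftS (fun n => iX21 (x n))) in xu.
  (* The residual is a difference of consecutive iterates, so it tends to 0. *)
  have B1x0 : B1 (F1 (iX21 (x n), y)) @[n --> \oo] --> u y - u y.
    by under eq_fun do rewrite residual; exact: cvgB.
  have := cvg_unique (@norm_hausdorff _ _) B1x B1x0; rewrite subrr => B1F1.
  by rewrite -(B1K (F1 _)) B1F1 linear0.
have u_uniq x y : `|x| < rho -> `|y| < delta -> G1 (x, y) = 0 -> x = u y.
  move=> xr yd Gxy; apply: iX10_inj; apply/eqP.
  rewrite -subr_eq0 -normr_le0.
  have := est1 x (u y) y y (ltr1 _ xr) (ltr1 _ (u_small _ yd))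
    (ltr1 _ (ltrho _ yd)) (ltr1 _ (ltrho _ yd)).
  rewrite Gxy u_sol// linear0 !subr0 subrr normr0 mulr0 addr0; lra.
have [dG dGP dGcont] := F_C1_1.
(* The inverses are chosen as a total function of p, to form the derivative. *)
have ex_inv (p : X1 * Y) : exists B : 'L(Z0, X0),
    `|p.1| < rho -> `|p.2| < rho ->
    op_inverse (A1 p) B /\ `|B| <= 2 * `|B0|.
  case: p => x y /=.
  have [xr|xr] := ltP `|x| rho; last by exists 0.
  have [yr|yr] := ltP `|y| rho; last by exists 0.
  have [B BP Ble] := neumann_inverse (A1 (0, 0)) (A1 (x, y)) B0
    (conj A0K B0K) (A1near _ _ (ltr4 _ xr) (ltr4 _ yr)).
  by exists B.
have [B_ B_P] := choice ex_inv.
pose C_ y : 'L(Y, Z0) := op_comp (dG (u y, y)) (op_inr X1 Y).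
pose du y : 'L(Y, X0) := - op_comp (B_ (u y, y)) (C_ y).
have B_u y : `|y| < delta ->
    op_inverse (A1 (u y, y)) (B_ (u y, y)) /\ `|B_ (u y, y)| <= 2 * `|B0|.
  by move=> yd; apply: B_P => /=; [exact: u_small|exact: ltrho].
have dG1 y : `|y| < delta -> is_diff (u y, y) G1 (dG (u y, y)).
  by move=> yd; apply: dGP; apply: mem_set; exact: D1u.
have C_E y : `|y| < delta -> forall k, C_ y k = 'd G1 (u y, y) (0, k).
  by move=> yd k; have dG1y := dG1 y yd; rewrite (@diff_val _ _ _ _ _ _ _ dG1y).
have u_diff y : `|y| < delta -> is_diff y (iX10 \o u) (du y).
  move=> yd; have dG1y := dG1 y yd.
  have near_delta k : `|k| < delta - `|y| -> `|y + k| < delta.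
    move=> kd; rewrite (le_lt_trans (ler_normD _ _))//; lra.
  apply: (@implicit_is_diff _ _ _ _ _ iX10 G1 u y (A1 (u y, y)) (B_ (u y, y))
    (C_ y) (delta - `|y|) (2 * K2)).
  - exact: ex_diff.
  - move=> h; rewrite A1_ext; last by apply: mem_set; exact: D1u.
    by rewrite partial_xE//; exact: ex_diff.
  - exact: C_E.
  - by case: (B_u _ yd) => -[].
  - by rewrite subr_gt0.
  - move=> k /near_delta ykd.
    by rewrite (le_trans (ulip _ _ (ltd _ ykd) (ltd _ yd)))// addrAC subrr add0r.
  - by move=> k /near_delta ykd; rewrite !u_sol.
have du_cont y : `|y| < delta -> {for y, continuous du}.
  move=> yd.
  have near_y : \forall z \near y, `|z| < delta.
    have : \forall z \near y, ball 0 delta z.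
      by apply: open_nbhs_nbhs; split; [exact: ball_open|rewrite mem_ball0].
    by apply: filterS => z; rewrite mem_ball0.
  have u_cont : u z @[z --> y] --> u y.
    apply/cvgrPdist_le => e e_gt0.
    have : \forall z \near y, `|y - z| <= e / (2 * K2 + 1).
      by apply: cvgr_dist_le; [exact: cvg_id|exact: divr_gt0].
    apply: filterS2 near_y => z zd; rewrite ler_pdivlMr// => yz.
    rewrite (le_trans (ulip _ _ (ltd _ yd) (ltd _ zd)))// (le_trans _ yz)//.
    by rewrite mulrDr mulr1 mulrC lerDl.
  have uy_cont : (u z, z) @[z --> y] --> (u y, y).
    by apply: cvg_pair => //; exact: cvg_id.
  have uyD : (u y, y) \in D1 by apply: mem_set; exact: D1u.
  apply: cvgN; apply: cvg_op_comp; last first.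
    apply: cvg_op_comp; last exact: cvg_cst.
    by apply: (cvg_comp _ _ uy_cont); exact: dGcont.
  have A_cont : A1 (u z, z) @[z --> y] --> A1 (u y, y).
    by apply: (cvg_comp _ _ uy_cont); exact: A1_cont.
  apply/cvgrPdist_le => e e_gt0.
  (* A positive bound of the norms of both inverses. *)
  pose b := 2 * `|B0| + 1.
  have b_gt0 : 0 < b by rewrite ltr_wpDl// mulr_ge0.
  have : \forall z \near y, `|A1 (u y, y) - A1 (u z, z)| <= e / (b * b).
    by apply: cvgr_dist_le => //; rewrite divr_gt0// mulr_gt0.
  apply: filterS2 near_y => z zd; rewrite ler_pdivlMr ?mulr_gt0// => yz.
  have [iy By] := B_u y yd; have [iz Bz] := B_u z zd.
  rewrite (le_trans (op_inverse_dist iy iz))// (le_trans _ yz)//.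
  rewrite mulrAC mulrC ler_wpM2l//.
  apply: ler_pM => //; [apply: (le_trans By)|apply: (le_trans Bz)];
    by rewrite lerDl.
exists setT, (ball 0 rho), (ball 0 delta); split.
- by split => //; exact: openT.
- by split; [exact: ball_open|exact: ballxx].
- by split; [exact: ball_open|exact: ballxx].
- move=> [x y] [/=]; rewrite !mem_ball0 => xr yd.
  by apply: D1r; apply: ltr1 => //; exact: ltrho.
exists u; split.
- by move=> y; rewrite !mem_ball0; exact: u_small.
- by split => // y; rewrite mem_ball0; exact: u_sol.
- by move=> x y; rewrite !mem_ball0; exact: u_uniq.
split.
  exists du => y; rewrite inE mem_ball0 => yd; first exact: u_diff.
  exact: du_cont.
move=> y; rewrite mem_ball0 => yd; exists (B_ (u y, y)), (C_ y).
have dG1y := dG1 y yd; split.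
- by case: (B_u _ yd).
- by move=> k; rewrite partial_yE ?C_E//; exact: ex_diff.
- by move=> k; have uy := u_diff y yd; rewrite (@diff_val _ _ _ _ _ _ _ uy).
Qed.
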